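(* Let $a,b,c,d\in\mathbb{R}$ with $ad-bc=1$ and $b\neq 0$, and let $A=(a,b,c,d)$. Then the linear canonical transform on Boehmians $$\mathcal{L}_A:\mathcal{B}_{\mathcal{L}^{1,2}}\longrightarrow\mathcal{B}_{\bigtriangledown},\qquad \mathcal{L}_A[f_n/\delta_n]=\mathcal{L}_A(f_n)/\mathcal{L}_A(\delta_n),$$ is a bijection.
   Context: Let $\mathcal{L}^{1,2}(\mathbb{R})=\mathcal{L}^1(\mathbb{R})\cap\mathcal{L}^2(\mathbb{R})$ (complex-valued functions on $\mathbb{R}$, identified when equal almost everywhere). Linear canonical transform of functions: for $f\in\mathcal{L}^{1,2}(\mathbb{R})$, $$\mathcal{L}_A(f)(u)=\sqrt{\tfrac{1}{2\pi i b}}\int_{-\infty}^{\infty}e^{\frac{i}{2}\left[\frac{a}{b}t^2-\frac{2}{b}ut+\frac{d}{b}u^2\right]}f(t)\,dt .$$ Convolution: $(f*^A g)(t)=\int_{-\infty}^{\infty}f(\tau)g(t-\tau)e^{i\tau(\tau-t)\frac{a}{b}}\,d\tau$. Delta sequences: $\bigtriangledown$ is the set of all sequences $\{\delta_n\}_{n\in\mathbb{N}}$ of continuous complex-valued functions on $\mathbb{R}$ with compact support, $\delta_n\in\mathcal{L}^{1,2}(\mathbb{R})$, such that (i) $\int_{\mathbb{R}}e^{i\frac{at^2}{2b}}\delta_n(t)\,dt=1$ for all $n\in\mathbb{N}$, and (ii) $\lim_{n\to\infty}\int_{|t|>\epsilon}|\delta_n(t)|\,dt=0$ for each $\epsilon>0$.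 The space $\mathcal{B}_{\mathcal{L}^{1,2}}$: a quotient of sequences $f_n/\varphi_n$ is a pair of sequences $(\{f_n\},\{\varphi_n\})$ with $f_n\in\mathcal{L}^{1,2}(\mathbb{R})$ for every $n\in\mathbb{N}$ and $\{\varphi_n\}\in\bigtriangledown$ such that $f_m*^A\varphi_n=f_n*^A\varphi_m$ for all $m,n\in\mathbb{N}$. Two quotients $f_n/\varphi_n$ and $g_n/\psi_n$ are equivalent if $f_n*^A\psi_n=g_n*^A\varphi_n$ for all $n\in\mathbb{N}$. The equivalence class of $f_n/\varphi_n$ is the Boehmian $[f_n/\varphi_n]$, and $\mathcal{B}_{\mathcal{L}^{1,2}}$ is the set of all such Boehmians. The space $\mathcal{B}_{\bigtriangledown}$: this is the Boehmian space built in the same way with pointwise multiplication $\cdot$ in place of $*^A$ and with denominators in $\bigtriangledown_0=\{\{\mathcal{L}_A(\delta_n)\}:\{\delta_n\}\in\bigtriangledown\}$. Its elements are the equivalence classes, denoted $\mathcal{L}_A(f_n)/\mathcal{L}_A(\delta_n)$, of pairs $(\{\mathcal{L}_A(f_n)\},\{\mathcal{L}_A(\delta_n)\})$ with $f_n\in\mathcal{L}^{1,2}(\mathbb{R})$ for every $n$ and $\{\delta_n\}\in\bigtriangledown$ such that $\mathcal{L}_A(f_n)\cdot\mathcal{L}_A(\delta_m)=\mathcal{L}_A(f_m)\cdot\mathcal{L}_A(\delta_n)$ for all $m,n\in\mathbb{N}$. Two pairs $\mathcal{L}_A(f_n)/\mathcal{L}_A(\psi_n)$ and $\mathcal{L}_A(g_n)/\mathcal{L}_A(\delta_n)$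 are equivalent if $\mathcal{L}_A(f_n)\cdot\mathcal{L}_A(\delta_n)=\mathcal{L}_A(g_n)\cdot\mathcal{L}_A(\psi_n)$ for all $n\in\mathbb{N}$. *)

(* Defs.v *)
From HB Require Import structures.
From mathcomp Require Import all_boot all_order all_algebra.
From mathcomp Require Import all_classical all_reals all_analysis.
From mathcomp Require Import complex.

Set Implicit Arguments.
Unset Strict Implicit.
Unset Printing Implicit Defensive.

Import Order.TTheory GRing.Theory Num.Theory.
Import numFieldNormedType.Exports.

Local Open Scope ring_scope.
Local Open Scope complex_scope.
Local Open Scope classical_set_scope.

Section complex_valued_functions.
Context (R : realType).
Local Notation mu := (@lebesgue_measure R).

Definition expi (x : R) : R[i] := cos x +i* sin x.

(* The library has no integral of complex-valued functions: integrate the real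
   and imaginary parts. *)
Definition cintegral (f : R -> R[i]) : R[i] :=
  (\int[mu]_t complex.Re (f t)) +i* (\int[mu]_t complex.Im (f t)).

Definition isL12 (f : R -> R[i]) : Prop :=
  [/\ measurable_fun [set: R] (fun t => complex.Re (f t)),
      measurable_fun [set: R] (fun t => complex.Im (f t)),
      finite_norm mu 1%E (fun t => Normc.normc (f t)) &
      finite_norm mu 2%:E (fun t => Normc.normc (f t))].

Record L12fun := MkL12fun { L12fun_val :> R -> R[i]; L12funP : isL12 L12fun_val }.

HB.instance Definition _ := gen_eqMixin L12fun.
HB.instance Definition _ := gen_choiceMixin L12fun.

Definition L12_ae_eq (f g : L12fun) : bool :=
  `[< ae_eq mu [set: R] (L12fun_val f) (L12fun_val g) >].

Let L12_ae_eq_refl : reflexive L12_ae_eq.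
Proof. by move=> f; apply/asboolP; exact: ae_eq_refl. Qed.

Let L12_ae_eq_sym : symmetric L12_ae_eq.
Proof. by move=> f g; apply/asboolP/asboolP => /ae_eq_sym. Qed.

Let L12_ae_eq_trans : transitive L12_ae_eq.
Proof.
move=> g f h /asboolP fg /asboolP gh; apply/asboolP; exact: ae_eq_trans fg gh.
Qed.

Canonical L12_ae_eq_equiv :=
  EquivRel L12_ae_eq L12_ae_eq_refl L12_ae_eq_sym L12_ae_eq_trans.

Local Open Scope quotient_scope.

Definition L12 : Type := {eq_quot L12_ae_eq}.
HB.instance Definition _ := Choice.on L12.
HB.instance Definition _ := EqQuotient.on L12.

(* The integrals below do not depend on the representative. *)
Definition L12_to_fun (f : L12) : R -> R[i] := repr f.

End complex_valued_functions.

Coercion L12_to_fun : L12 >-> Funclass.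

(* The set of classes of a relation [e], which is only meant to be used when [e]
   is an equivalence relation. *)
Section eclasses.
Context (T : Type) (e : T -> T -> Prop).

Definition eclass (x : T) : set T := [set y | e x y].

Definition eclasses : Type := range eclass.

Definition to_eclass (x : T) : eclasses := SigSub (mem_set (imageT eclass x)).

End eclasses.

Record lct_param (R : Type) := LctParam {
  lct_a : R; lct_b : R; lct_c : R; lct_d : R }.

Section linear_canonical_transform.
Context (R : realType) (A : lct_param R).
Local Notation mu := (@lebesgue_measure R).
Local Notation a := (lct_a A).
Local Notation b := (lct_b A).
Local Notation d := (lct_d A).

(* [sqrtc] is the principal branch, unlike [sqrtC]. *)
Definition lct (f : R -> R[i]) (u : R) : R[i] :=
  sqrtc (1 / (2%:R * (pi * b)%:C * 'i)) *
  cintegral (fun t =>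
    expi (2^-1 * (a / b * t ^+ 2 - 2 / b * u * t + d / b * u ^+ 2)) * f t).

Definition lct_conv (f g : R -> R[i]) (t : R) : R[i] :=
  cintegral (fun tau => f tau * g (t - tau) * expi (tau * (tau - t) * (a / b))).

Definition delta_seq (delta : nat -> R -> R[i]) : Prop :=
  [/\ forall n, continuous (delta n : R -> R[i]^o),
      forall n, compact (closure [set t | delta n t != 0]),
      forall n, isL12 (delta n),
      forall n, cintegral (fun t => expi (a * t ^+ 2 / (2 * b)) * delta n t) = 1 &
      forall eps : R, 0 < eps ->
        (\int[mu]_(t in [set t : R | (eps < `|t|)%R]) (Normc.normc (delta n t))%:E)%E
          @[n --> \oo] --> 0%E].

Record conv_quotient := ConvQuotient {
  qnum : nat -> L12 R;
  qden : nat -> R -> R[i];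
  qdenP : delta_seq qden;
  qnum_qden : forall m n,
    ae_eq mu [set: R] (lct_conv (qnum m) (qden n)) (lct_conv (qnum n) (qden m)) }.

Definition conv_quotient_equiv (p q : conv_quotient) : Prop :=
  forall n,
    ae_eq mu [set: R] (lct_conv (qnum p n) (qden q n))
                      (lct_conv (qnum q n) (qden p n)).

Definition boehmian : Type := eclasses conv_quotient_equiv.

Definition to_boehmian (q : conv_quotient) : boehmian :=
  to_eclass conv_quotient_equiv q.

(* Transforms are defined at every point, and are compared at every point. *)
Record lct_quotient := LctQuotient {
  lct_qnum : nat -> R -> R[i];
  lct_qden : nat -> R -> R[i];
  lct_qnumP : exists f : nat -> L12 R, forall n, lct_qnum n = lct (f n);
  lct_qdenP : exists2 delta, delta_seq delta &
    forall n, lct_qden n = lct (delta n);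
  lct_qnum_qden : forall m n, lct_qnum n \* lct_qden m = lct_qnum m \* lct_qden n }.

Definition lct_quotient_equiv (p q : lct_quotient) : Prop :=
  forall n, lct_qnum p n \* lct_qden q n = lct_qnum q n \* lct_qden p n.

Definition lct_boehmian : Type := eclasses lct_quotient_equiv.

Definition to_lct_boehmian (q : lct_quotient) : lct_boehmian :=
  to_eclass lct_quotient_equiv q.

End linear_canonical_transform.

(* Main.v *)
Require Import Defs.
From mathcomp Require Import all_boot all_order all_algebra.
From mathcomp Require Import all_classical all_reals all_analysis.
From mathcomp Require Import measurable_realfun complex ring lra.

(** The chirp [F t = expi (a t^2 / 2b) * f t] turns the convolution [*^A] into
    the ordinary convolution, and [lct A f u] is the Fourier transform of [F] at
    [u / b] times a factor that depends on [u] alone and never vanishes.  By the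
    convolution theorem, [lct A f u * lct A g u] is then a nonvanishing multiple
    of the Fourier transform of the ordinary convolution of the two chirped
    functions.  Since an integrable function whose Fourier transform vanishes is
    null, two products [f1 *^A g1] and [f2 *^A g2] agree almost everywhere if
    and only if the products of their transforms agree at every point
    ([ae_eq_lct_convP]).  Applied to a pair of sequences, this says that taking
    transforms sends quotients to quotients, that it preserves and reflects
    equivalence, and that every quotient of transforms is reached.  The
    bijection on classes is then formal ([eclasses_bijection]), as soon as the
    relation between quotients of transforms is known to be transitive.

    Transitivity requires cancelling the transform of a term of a delta
    sequence.  The L1 norms of a delta sequence need not be bounded, so these
    transforms need not converge to a nonzero limit, and they may even all vanish
    at a common point.  Compactness of the supports is what helps: the Fourier
    transform of a compactly supported function vanishes on no interval, unless
    the function is null ([compact_fourier_eq0]).  It can therefore be cancelled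
    from an identity between continuous functions ([fourier_cancel]).

    Both uniqueness results for the Fourier transform come from one device.  Let
    [null_freq D K] be the class of integrable functions supported in [K] whose
    cosine and sine integrals vanish at all frequencies in [D].  This class is
    closed under linear combinations and dominated limits.  If it is also closed
    under multiplication by a function [s] with values in the unit interval, then
    the polynomials [(1 - s^n)^(n 2^n)], which tend to the indicator of
    [s < 1/2], show that it is closed under multiplication by that indicator
    ([null_freq_step]).  For [D] the whole line, [s] may be a sine wave, because
    multiplication by a sine or a cosine only shifts frequencies; letting its
    period grow produces the indicators of half-lines.  For [D] an interval around
    zero and [K] bounded, multiplication by the variable is available as the limit
    of [sin (r t) / r], and [s] may be affine.  Either way the integral over every
    half-line vanishes, so the function is null by Lebesgue differentiation. *)

Set Implicit Arguments.
Unset Strict Implicit.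
Unset Printing Implicit Defensive.

Import Order.TTheory GRing.Theory Num.Theory.
Import numFieldNormedType.Exports.

Local Open Scope ring_scope.
Local Open Scope classical_set_scope.

(** * Polynomials that converge to a step *)

Section step_polynomials.
Context {R : realType}.
Implicit Types (x y r : R) (n k : nat).

Lemma bernoulli_sub y k : 0 <= y <= 1 -> 1 - k%:R * y <= (1 - y) ^+ k.
Proof.
move=> /andP[y0 y1]; elim: k => [|k IH]; first by rewrite mul0r subr0 expr0.
rewrite exprS; apply: (@le_trans _ _ ((1 - y) * (1 - k%:R * y))).
  have : 0 <= k%:R * y * y by rewrite !mulr_ge0.
  by rewrite -natr1; lra.
by rewrite ler_wpM2l// subr_ge0.
Qed.

Lemma bernoulli_add y k : 0 <= y -> 1 + k%:R * y <= (1 + y) ^+ k.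
Proof.
move=> y0; elim: k => [|k IH]; first by rewrite mul0r addr0 expr0.
rewrite exprS; apply: (@le_trans _ _ ((1 + y) * (1 + k%:R * y))).
  have : 0 <= k%:R * y * y by rewrite !mulr_ge0.
  by rewrite -natr1; lra.
by rewrite ler_wpM2l// addr_ge0.
Qed.

(** With [q = sqrt r], the sequence [n q^n] is bounded by Bernoulli's
    inequality, which leaves a factor [q^n] for the convergence. *)
Lemma cvg_natM_expr r : 0 <= r < 1 -> n%:R * r ^+ n @[n --> \oo] --> (0 : R).
Proof.
move=> /andP[r0 r1].
have [->|rn0] := eqVneq r 0.
  rewrite (_ : (fun n => _) = fun=> 0); first exact: cvg_cst.
  by apply/funext => -[|n]; rewrite ?mul0r// exprS mul0r mulr0.
have rp : 0 < r by rewrite lt_def rn0.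
pose q := Num.sqrt r.
have qp : 0 < q by rewrite sqrtr_gt0.
have q2 : q ^+ 2 = r by rewrite sqr_sqrtr.
have q1 : q < 1 by rewrite -(@ltr_pXn2r _ 2)// ?nnegrE ?ltW// q2 expr1n.
pose e := q^-1 - 1.
have ep : 0 < e by rewrite subr_gt0 invf_gt1.
have bound n : n%:R * q ^+ n <= e^-1.
  have := @bernoulli_add e n (ltW ep).
  rewrite (_ : 1 + e = q^-1); last by rewrite /e addrC subrK.
  rewrite exprVn => H.
  have qn : 0 < q ^+ n by rewrite exprn_gt0.
  rewrite -(ler_pM2r qn) mulVf ?gt_eqF// in H.
  rewrite -(ler_pM2r ep) mulVf ?gt_eqF//.
  by nra.
apply: (@squeeze_cvgr _ _ _ _ (fun=> 0) (fun n => e^-1 * q ^+ n)).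
- apply: nearW => n; rewrite mulr_ge0 ?exprn_ge0//=.
  rewrite -q2 -exprM mulnC muln2 -addnn exprD mulrA.
  by rewrite ler_wpM2r// exprn_ge0// ltW.
- exact: cvg_cst.
- by apply: (@cvg_geometric _ e^-1 q); rewrite ger0_norm// ltW.
Qed.

(** The factor [n] in the exponent makes the limit vanish at [x = 1/2] too, so
    that the limit is an indicator at every point of the unit interval. *)
Definition step_poly n x : R := (1 - x ^+ n) ^+ (n * 2 ^ n).

Lemma step_poly_itv n x : 0 <= x <= 1 -> 0 <= step_poly n x <= 1.
Proof.
move=> /andP[x0 x1].
have xn1 : x ^+ n <= 1 by rewrite exprn_ile1.
have xn0 : 0 <= x ^+ n by rewrite exprn_ge0.
by rewrite exprn_ge0/= ?exprn_ile1//; lra.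
Qed.

(** Both cases are Bernoulli's inequality.  Below one half, it bounds
    [1 - step_poly n x] by [n (2x)^n].  From one half on, [(1 - y)(1 + y) <= 1]
    with [y = x^n] bounds [step_poly n x] by the inverse of
    [1 + n 2^n x^n >= 1 + n]. *)
Lemma cvg_step_poly x : 0 <= x <= 1 ->
  step_poly n x @[n --> \oo] --> ((x < 2^-1)%R%:R : R).
Proof.
move=> xI; have /andP[x0 x1] := xI.
have xn1 n : x ^+ n <= 1 by rewrite exprn_ile1.
have xn0 n : 0 <= x ^+ n by rewrite exprn_ge0.
have [xlt|xge] := ltrP x 2^-1.
- apply: (@squeeze_cvgr _ _ _ _ (fun n => 1 - n%:R * (2 * x) ^+ n) (fun=> 1)).
  + apply: nearW => n; have /andP[_ ->] := step_poly_itv n xI; rewrite andbT.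
    apply: le_trans (@bernoulli_sub (x ^+ n) (n * 2 ^ n) _); last first.
      by rewrite xn0 xn1.
    by rewrite natrM natrX exprMn mulrA.
  + rewrite [X in _ --> X](_ : _ = 1 - 0 :> R); last by rewrite subr0.
    apply: cvgB; first exact: cvg_cst.
    by apply: cvg_natM_expr; lra.
  + exact: cvg_cst.
- apply: (@squeeze_cvgr _ _ _ _ (fun=> 0) (fun n => (n.+1%:R)^-1)).
  + apply: nearW => n; have /andP[-> _] := step_poly_itv n xI.
    have kx : n%:R <= (n * 2 ^ n)%:R * x ^+ n.
      rewrite natrM natrX -mulrA -exprMn -[leLHS]mulr1 ler_wpM2l//.
      by rewrite exprn_ege1//; lra.
    rewrite -[leRHS]mul1r ler_pdivlMr//.
    have := @bernoulli_add (x ^+ n) (n * 2 ^ n) (xn0 n).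
    have : step_poly n x * (1 + x ^+ n) ^+ (n * 2 ^ n) <= 1.
      rewrite -exprMn (_ : _ * _ = 1 - x ^+ n * x ^+ n); last by ring.
      have : x ^+ n * x ^+ n <= 1 by rewrite mulr_ile1.
      have : 0 <= x ^+ n * x ^+ n by rewrite mulr_ge0.
      by move=> ? ?; rewrite exprn_ile1//; lra.
    have /andP[s0 _] := step_poly_itv n xI.
    move=> H1 H2; apply: le_trans H1; rewrite ler_wpM2l// -natr1; lra.
  + exact: cvg_cst.
  + exact: cvg_harmonic.
Qed.

End step_polynomials.

(** * Integrable functions with vanishing frequencies *)

Section null_frequencies.
Context {R : realType}.
Local Notation mu := (@lebesgue_measure R).
Implicit Types (f g h k s : R -> R) (D K : set R).

(** The bound on the multiplier is only asked on the support of [h], because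
    the variable [t] is later used as a multiplier of functions with bounded
    support. *)
Lemma integrable_mul_bounded k h c : measurable_fun setT k ->
  (forall t, h t != 0 -> `|k t| <= c) -> mu.-integrable setT (EFin \o h) ->
  mu.-integrable setT (EFin \o (k \* h)).
Proof.
move=> mk kc ih.
have mh : measurable_fun setT h.
  by apply/measurable_EFinP; exact: measurable_int ih.
apply: (@le_integrable _ _ _ mu setT measurableT _
  (EFin \o (fun t => c * h t))).
- by apply/measurable_EFinP; exact: measurable_funM.
- move=> t _; rewrite /= lee_fin !normrM.
  have [->|h0] := eqVneq (h t) 0; first by rewrite normr0 !mulr0.
  by rewrite ler_wpM2r// (le_trans (kc _ h0))// ler_norm.
- exact: (@integrableZl _ _ _ mu setT measurableT c (EFin \o h)).
Qed.

Lemma measurable_Rfun_integrable (f : R -> R) :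
  mu.-integrable setT (EFin \o f) -> measurable_fun setT f.
Proof. by move=> fi; apply/measurable_EFinP; exact: measurable_int fi. Qed.

Lemma integrable_mul_bounded1 (k h : R -> R) : measurable_fun setT k ->
  (forall t, `|k t| <= 1) -> mu.-integrable setT (EFin \o h) ->
  mu.-integrable setT (EFin \o (fun t => k t * h t)).
Proof. by move=> mk k1; apply: (@integrable_mul_bounded k h 1). Qed.

Lemma Rdominated_convergence (f_ : nat -> R -> R) f g :
  (forall n, measurable_fun setT (f_ n)) ->
  mu.-integrable setT (EFin \o g) ->
  (forall n t, `|f_ n t| <= g t) ->
  (forall t, f_ n t @[n --> \oo] --> f t) ->
  mu.-integrable setT (EFin \o f) /\
  \int[mu]_t f_ n t @[n --> \oo] --> \int[mu]_t f t.
Proof.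
move=> mf ig fg ff.
have mfl : measurable_fun setT f.
  by apply: (@measurable_fun_cvg _ _ _ setT f_) => // t _; exact: ff.
have [] := @dominated_convergence _ _ _ mu setT measurableT
    (fun n => EFin \o f_ n) (EFin \o f) (EFin \o g).
- by move=> n; apply/measurable_EFinP; exact: mf.
- by apply/measurable_EFinP; exact: mfl.
- by apply: aeW => t _; apply: cvg_EFin => //; [exact: nearW|exact: ff].
- exact: ig.
- by apply: aeW => t n _; rewrite lee_fin.
move=> fi _ cvgf; split => //.
apply: fine_cvg; rewrite /Rintegral fineK//.
exact: integrable_fin_num.
Qed.

(** [D] is the set of frequencies at which the transform vanishes, and [K] is a
    set that contains the support.  Real functions are used so that the
    cosine and sine integrals vanish separately; [null_freq_fourier] reduces the
    complex case to this one when [D] is symmetric. *)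
Definition null_freq D K h :=
  [/\ mu.-integrable setT (EFin \o h), forall t, ~ K t -> h t = 0 &
      forall w, D w -> \int[mu]_t (cos (w * t) * h t) = 0 /\
                       \int[mu]_t (sin (w * t) * h t) = 0].

Lemma measurable_cosM (w : R) : measurable_fun setT (fun t : R => cos (w * t)).
Proof.
apply: measurableT_comp; last exact: measurable_funM.
by apply: continuous_measurable_fun; exact: continuous_cos.
Qed.

Lemma measurable_sinM (w : R) : measurable_fun setT (fun t : R => sin (w * t)).
Proof.
apply: measurableT_comp; last exact: measurable_funM.
by apply: continuous_measurable_fun; exact: continuous_sin.
Qed.

Lemma integrable_cosM w h : mu.-integrable setT (EFin \o h) ->
  mu.-integrable setT (EFin \o (fun t => cos (w * t) * h t)).
Proof.
apply: integrable_mul_bounded1; first exact: measurable_cosM.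
by move=> t; exact: cos_max.
Qed.

Lemma integrable_sinM w h : mu.-integrable setT (EFin \o h) ->
  mu.-integrable setT (EFin \o (fun t => sin (w * t) * h t)).
Proof.
apply: integrable_mul_bounded1; first exact: measurable_sinM.
by move=> t; exact: sin_max.
Qed.

Lemma integrable_lin (x y : R) f g : mu.-integrable setT (EFin \o f) ->
  mu.-integrable setT (EFin \o g) ->
  mu.-integrable setT (EFin \o (fun t => x * f t + y * g t)).
Proof.
move=> fi gi; apply: (@integrableD _ _ _ mu setT measurableT
  (EFin \o (fun t => x * f t)) (EFin \o (fun t => y * g t))).
- exact: (@integrableZl _ _ _ mu setT measurableT x (EFin \o f)).
- exact: (@integrableZl _ _ _ mu setT measurableT y (EFin \o g)).
Qed.

Lemma Rintegral_lin (x y : R) f g : mu.-integrable setT (EFin \o f) ->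
  mu.-integrable setT (EFin \o g) ->
  \int[mu]_t (x * f t + y * g t) = x * \int[mu]_t f t + y * \int[mu]_t g t.
Proof.
move=> fi gi; rewrite RintegralD//.
- by rewrite !RintegralZl.
- exact: (@integrableZl _ _ _ mu setT measurableT x (EFin \o f)).
- exact: (@integrableZl _ _ _ mu setT measurableT y (EFin \o g)).
Qed.

Lemma null_freq_lin D K (x y : R) f g : null_freq D K f -> null_freq D K g ->
  null_freq D K (fun t => x * f t + y * g t).
Proof.
move=> [fi fK fD] [gi gK gD]; split.
- exact: integrable_lin.
- by move=> t Kt; rewrite fK// gK// !mulr0 addr0.
- move=> w Dw; have [fc fs] := fD _ Dw; have [gc gs] := gD _ Dw; split.
  + under eq_Rintegral do rewrite mulrDr !(mulrCA (cos _)).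
    by rewrite Rintegral_lin ?fc ?gc ?mulr0 ?addr0//; exact: integrable_cosM.
  + under eq_Rintegral do rewrite mulrDr !(mulrCA (sin _)).
    by rewrite Rintegral_lin ?fs ?gs ?mulr0 ?addr0//; exact: integrable_sinM.
Qed.

Lemma null_freq_lim D K (h_ : nat -> R -> R) h g :
  (forall n, null_freq D K (h_ n)) ->
  mu.-integrable setT (EFin \o g) ->
  (forall n t, `|h_ n t| <= g t) ->
  (forall t, h_ n t @[n --> \oo] --> h t) ->
  null_freq D K h.
Proof.
move=> h0 ig hg hh.
have mh n : measurable_fun setT (h_ n).
  by apply/measurable_EFinP; have [/measurable_int + _ _] := h0 n.
have [ih _] := Rdominated_convergence mh ig hg hh.
have key k : measurable_fun setT k -> (forall t, `|k t| <= 1) ->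
    (forall n, \int[mu]_t (k t * h_ n t) = 0) -> \int[mu]_t (k t * h t) = 0.
  move=> mk k1 kh0.
  have [|||_] := @Rdominated_convergence (fun n t => k t * h_ n t)
    (fun t => k t * h t) g _ ig.
  - by move=> n; exact: measurable_funM.
  - move=> n t; rewrite normrM; apply: le_trans (hg n t).
    by rewrite -[leRHS]mul1r ler_wpM2r.
  - by move=> t; apply: cvgM; [exact: cvg_cst|exact: hh].
  rewrite (_ : (fun n => _) = fun=> 0); last exact/funext.
  by move=> H; apply: (cvg_unique _ H) => //; exact: cvg_cst.
split => //.
- move=> t Kt; apply: (cvg_unique _ (hh t)) => //.
  rewrite (_ : (fun n => _) = fun=> 0); first exact: cvg_cst.
  by apply/funext => n; have [_ + _] := h0 n; apply.
- move=> w Dw; split; apply: key.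
  + exact: measurable_cosM.
  + by move=> t; exact: cos_max.
  + by move=> n; have [_ _ /(_ _ Dw) []] := h0 n.
  + exact: measurable_sinM.
  + by move=> t; exact: sin_max.
  + by move=> n; have [_ _ /(_ _ Dw) []] := h0 n.
Qed.

(** The product formulas for sines and cosines move the frequency [v] to
    [v + w] and [v - w]. *)
Lemma null_freq_modulate D D' K (w : R) h :
  (forall v, D' v -> D (v + w) /\ D (v - w)) -> null_freq D K h ->
  null_freq D' K (fun t => cos (w * t) * h t) /\
  null_freq D' K (fun t => sin (w * t) * h t).
Proof.
move=> DD' [hi hK hD].
have lin4 (f1 f2 : R -> R) (x y : R) (k1 k2 : R -> R) :
    mu.-integrable setT (EFin \o f1) -> mu.-integrable setT (EFin \o f2) ->
    \int[mu]_t f1 t = 0 -> \int[mu]_t f2 t = 0 ->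
    (forall t, k1 t * (k2 t * h t) = x * f1 t + y * f2 t) ->
    \int[mu]_t (k1 t * (k2 t * h t)) = 0.
  move=> i1 i2 z1 z2 e; under eq_Rintegral do rewrite e.
  by rewrite Rintegral_lin// z1 z2 !mulr0 addr0.
split; split.
- exact: integrable_cosM.
- by move=> t Kt; rewrite hK// mulr0.
- move=> v /DD'[/hD[cp sp] /hD[cm sm]]; split.
  + apply: (lin4 _ _ 2^-1 2^-1 _ _ _ _ cp cm); [exact: integrable_cosM..|].
    by move=> t; rewrite mulrDl mulrBl cosB cosD; field.
  + apply: (lin4 _ _ 2^-1 2^-1 _ _ _ _ sp sm); [exact: integrable_sinM..|].
    by move=> t; rewrite mulrDl mulrBl sinB sinD; field.
- exact: integrable_sinM.
- by move=> t Kt; rewrite hK// mulr0.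
- move=> v /DD'[/hD[cp sp] /hD[cm sm]]; split.
  + apply: (lin4 _ _ 2^-1 (- 2^-1) _ _ _ _ sp sm); [exact: integrable_sinM..|].
    by move=> t; rewrite mulrDl mulrBl sinB sinD; field.
  + apply: (lin4 _ _ (- 2^-1) 2^-1 _ _ _ _ cp cm); [exact: integrable_cosM..|].
    by move=> t; rewrite mulrDl mulrBl cosB cosD; field.
Qed.

(** Any polynomial in [s] is again an admissible multiplier; the step polynomials
    in [s] are bounded by one where [h] does not vanish, so dominated
    convergence applies. *)
Lemma null_freq_step D K s h :
  (forall f, null_freq D K f -> null_freq D K (s \* f)) ->
  (forall t, h t != 0 -> 0 <= s t <= 1) ->
  null_freq D K h ->
  null_freq D K (fun t => (s t < 2^-1)%R%:R * h t).
Proof.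
move=> sD s01 hD.
have pow_s n f : null_freq D K f -> null_freq D K (fun t => s t ^+ n * f t).
  move=> fD; elim: n => [|n IH].
    by rewrite (_ : (fun _ => _) = f)//; apply/funext => t; rewrite expr0 mul1r.
  rewrite (_ : (fun _ => _) = s \* (fun t => s t ^+ n * f t)); first exact: sD.
  by apply/funext => t; rewrite /= exprS mulrA.
have poly_s n : null_freq D K (fun t => step_poly n (s t) * h t).
  rewrite /step_poly; elim: (n * 2 ^ n)%N => [|m IH].
    by rewrite (_ : (fun _ => _) = h)//; apply/funext => t; rewrite expr0 mul1r.
  have /(null_freq_lin 1 (-1) IH) := pow_s n _ IH.
  by congr null_freq; apply/funext => t; rewrite exprS; ring.
apply: (null_freq_lim poly_s (g := fun t => `|h t|)).
- by case: hD => hi _ _; exact: integrable_norm.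
- move=> n t; have [->|h0] := eqVneq (h t) 0; first by rewrite mulr0 normr0.
  have /andP[p0 p1] := step_poly_itv n (s01 _ h0).
  by rewrite normrM -[leRHS]mul1r ler_wpM2r// ger0_norm.
- move=> t; have [->|h0] := eqVneq (h t) 0.
    by rewrite mulr0; under eq_fun do rewrite mulr0; exact: cvg_cst.
  by apply: cvgM; [exact/cvg_step_poly/s01|exact: cvg_cst].
Qed.

(** The primitive of [h] is constant, and by Lebesgue differentiation its
    derivative is [h] almost everywhere. *)
Lemma ae0_halflines h : mu.-integrable setT (EFin \o h) ->
  (forall x : R, \int[mu]_t ((t < x)%R%:R * h t) = 0) ->
  ae_eq mu setT h (cst 0).
Proof.
move=> ih h0.
have ihx (A : set R) : measurable A -> mu.-integrable A (EFin \o h).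
  by move=> mA; exact: integrableS ih.
have loch : locally_integrable setT h.
  by have := integrable_locally measurableT ih; rewrite patch_setT.
have ihy (y : R) : mu.-integrable `]-oo, y] (EFin \o h) by exact: ihx.
have := FTC1Ny ihy loch.
have F0 : (fun x => \int[mu]_(t in `]-oo, x]) h t) = cst 0.
  apply/funext => x.
  rewrite -Rintegral_itv_bndo_bndc; last exact: ihx.
  rewrite Rintegral_mkcond -[RHS](h0 x).
  apply: eq_Rintegral => t _; rewrite /patch mem_setE in_itv/=.
  by case: (t < x); rewrite ?mul1r ?mul0r.
rewrite /= F0; apply: filterS; first exact: (ae_filter_ringOfSetsType mu).
move=> t [_ <- _].
by rewrite derive1_cst.
Qed.

End null_frequencies.

(** * Uniqueness for real functions *)

Section fourier_uniqueness.
Context {R : realType}.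
Local Notation mu := (@lebesgue_measure R).
Implicit Types (h : R -> R) (K : set R).

Lemma null_freq_Rintegral0 D K h : D 0 -> null_freq D K h -> \int[mu]_t h t = 0.
Proof.
move=> D0 [_ _ /(_ _ D0) [+ _]].
by under eq_Rintegral do rewrite mul0r cos0 mul1r.
Qed.

Lemma sin_lt0_small (x : R) : `|x| < pi -> (sin x < 0) = (x < 0).
Proof.
rewrite ltr_norml => /andP[xl xu]; have [x0|x0|->] := ltrgtP x 0.
- by rewrite -oppr_gt0 -sinN sin_gt0_pi// oppr_gt0 x0/= ltrNl.
- by apply/negbTE; rewrite -leNgt ltW// sin_gt0_pi// x0.
- by rewrite sin0 ltxx.
Qed.

(** The multiplier [s n] is below one half exactly where
    [sin ((t - x) / (n + 1))] is negative, and for large [n] this means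
    [t < x]. *)
Lemma null_freq_setT_ae0 K h : null_freq setT K h -> ae_eq mu setT h (cst 0).
Proof.
move=> hT; have [ih _ _] := hT.
apply: ae0_halflines => // x.
pose s n (t : R) := 2^-1 + 2^-1 * sin (n.+1%:R^-1 * (t - x)).
have s01 n t : 0 <= s n t <= 1.
  have := sin_max (n.+1%:R^-1 * (t - x)); rewrite ler_norml => /andP[? ?].
  by rewrite /s; apply/andP; split; lra.
have sK n f : null_freq setT K f -> null_freq setT K (s n \* f).
  move=> fT.
  have [//|fc fs] := @null_freq_modulate _ setT setT K n.+1%:R^-1 _ _ fT.
  have := null_freq_lin (cos (n.+1%:R^-1 * x)) (- sin (n.+1%:R^-1 * x)) fs fc.
  move/(null_freq_lin 2^-1 2^-1 fT).
  by congr null_freq; apply/funext => t; rewrite /s /= mulrBr sinB; ring.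
have hx : null_freq setT K (fun t => (t < x)%R%:R * h t).
  apply: (@null_freq_lim _ _ _ (fun n t => (s n t < 2^-1)%R%:R * h t) _
    (fun t => `|h t|)).
  - by move=> n; apply: (null_freq_step (sK n) _ hT) => t _; exact: s01.
  - exact: (integrable_norm ih).
  - move=> n t; rewrite normrM normr_nat.
    by case: (_ < _); rewrite ?mul1r ?mul0r.
  - move=> t; apply: cvg_near_cst.
    have : n.+1%:R^-1 * `|t - x| @[n --> \oo] --> (0 : R).
      rewrite -[X in _ --> X](mul0r `|t - x|).
      by apply: cvgM; [exact: cvg_harmonic|exact: cvg_cst].
    move/cvgr_lt => /(_ _ (pi_gt0 R)); apply: filterS => n lt_pi.
    congr ((nat_of_bool _)%:R * _); rewrite /s.
    rewrite -(subr_lt0 x t) -(pmulr_rlt0 (t - x) (_ : 0 < n.+1%:R^-1))//.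
    rewrite -sin_lt0_small; first by apply/idP/idP; lra.
    by rewrite normrM ger0_norm.
exact: null_freq_Rintegral0 hx.
Qed.

Lemma sin_le_norm (x : R) : `|sin x| <= `|x|.
Proof.
wlog x0 : x / 0 <= x => [H|].
  have [/H//|/ltW x0] := leP 0 x.
  by rewrite -normrN -sinN -[leRHS]normrN H// oppr_ge0.
have [->|xn0] := eqVneq x 0; first by rewrite sin0.
have xp : 0 < x by rewrite lt_def xn0.
have [c _] := @MVT _ sin cos 0 x xp (fun y _ => is_derive_sin y)
  (continuous_subspaceT (@continuous_sin R)).
rewrite sin0 !subr0 => ->.
by rewrite normrM -[leRHS]mul1r ler_wpM2r// cos_max.
Qed.

Lemma cvg_sinM_div (t : R) (r : nat -> R) : (forall n, r n != 0) ->
  r n @[n --> \oo] --> 0 ->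
  (r n)^-1 * sin (r n * t) @[n --> \oo] --> t.
Proof.
move=> r0 rl.
have /is_derive1_caratheodory[g [sing cg g0]] := is_derive_sin (0 : R).
have e n : (r n)^-1 * sin (r n * t) = g (r n * t) * t.
  have := sing (r n * t); rewrite sin0 !subr0 => ->.
  by rewrite mulrCA mulKf.
rewrite (_ : (fun n => _) = (fun n => g (r n * t) * t)); last exact/funext.
have tE : g 0 * t = t by rewrite g0 cos0 mul1r.
rewrite -[X in _ --> X]tE.
apply: cvgM; last exact: cvg_cst.
apply: continuous_cvg; first exact: cg.
rewrite -[X in _ --> X](mul0r t).
by apply: cvgM; [exact: rl|exact: cvg_cst].
Qed.

(** This is differentiation of the transform in disguise: [t * h t] is the limit
    of [sin (r t) / r * h t] as [r] tends to zero, and multiplication by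
    [sin (r t)] costs a margin [r] in the set of frequencies.  At a given
    frequency [w] the margin [d - |w|] is positive, so [r] may be taken below
    it. *)
Lemma null_freq_mulX (d T : R) h : 
  null_freq [set w | `|w| < d] [set t | `|t| <= T] h ->
  null_freq [set w | `|w| < d] [set t | `|t| <= T] (fun t => t * h t).
Proof.
move=> hd; have [ih hK _] := hd.
split.
- apply: (@integrable_mul_bounded _ id h T) => // t h0.
  by apply: contrapT => Kt; move: h0; rewrite hK ?eqxx.
- by move=> t Kt; rewrite hK// mulr0.
- move=> w wd; pose e := d - `|w|.
  have e0 : 0 < e by rewrite subr_gt0.
  (* the divisor is at least two, so that [r n] stays strictly below [e] *)
  pose r n : R := e / n.+2%:R.
  have r0 n : 0 < r n by rewrite divr_gt0.
  have re n : r n < e by rewrite /r ltr_pdivrMr// ltr_pMr// ltr1n.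
  suff [_ _ /(_ w erefl)//] :
    null_freq [set w] [set t | `|t| <= T] (fun t => t * h t).
  apply: (@null_freq_lim _ _ _ (fun n t => (r n)^-1 * sin (r n * t) * h t) _
    (fun t => `|t * h t|)).
  - move=> n; have [|_ hs] := @null_freq_modulate _ _ [set w] _ (r n) _ _ hd.
      move=> v ->; have /(_ n) := re; have := r0 n; rewrite /e => ? ?.
      split => /=.
        by rewrite (le_lt_trans (ler_normD _ _))// (gtr0_norm (r0 n)); lra.
      by rewrite (le_lt_trans (ler_normB _ _))// (gtr0_norm (r0 n)); lra.
    have := null_freq_lin (r n)^-1 0 hs hs.
    by congr null_freq; apply/funext => t; rewrite mul0r addr0 mulrA.
  - apply: integrable_norm; apply: (@integrable_mul_bounded _ id h T) => // t h0.
    by apply: contrapT => Kt; move: h0; rewrite hK ?eqxx.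
  - move=> n t; rewrite normrM [leRHS]normrM ler_wpM2r// normrM.
    rewrite gtr0_norm ?invr_gt0// ler_pdivrMl//.
    by rewrite (le_trans (sin_le_norm _))// normrM (gtr0_norm (r0 n)).
  - move=> t; apply: cvgM; last exact: cvg_cst.
    apply: cvg_sinM_div => [n|]; first by rewrite gt_eqF.
    rewrite -[X in _ --> X](mulr0 e); apply: cvgM; first exact: cvg_cst.
    by have := @cvg_harmonic R; rewrite -cvg_shiftS.
Qed.

(** When [|x| <= T], the affine multiplier [s] takes its values in the unit
    interval for [|t| <= T], and it is below one half exactly for [t < x].  For
    the other [x], the half-line contains the support or misses it. *)
Lemma null_freq_compact_ae0 (d T : R) h : 0 < d ->
  null_freq [set w | `|w| < d] [set t | `|t| <= T] h ->
  ae_eq mu setT h (cst 0).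
Proof.
move=> d0.
wlog T0 : T / 0 < T => [H [ih hK hd]|hd].
  apply: (H (`|T| + 1)); first by rewrite ltr_wpDl.
  split => // t /= /negP; rewrite -ltNge => Tt; apply: hK => /= tT.
  by have := ler_norm T; lra.
have [ih hK _] := hd.
have D0 : [set w : R | `|w| < d] 0 by rewrite /= normr0.
apply: ae0_halflines => // x.
have [xT|xT] := ltP T x.
  rewrite -[RHS](null_freq_Rintegral0 D0 hd); apply: eq_Rintegral => t _.
  have [tT|tT] := leP `|t| T; last by rewrite hK ?mulr0//= leNgt tT.
  by rewrite (le_lt_trans _ xT) ?mul1r// (le_trans _ tT)// ler_norm.
have [xNT|xNT] := ltP x (- T).
  rewrite (_ : (fun t => _) = cst 0) ?Rintegral_cst// ?mul0r//.
  apply/funext => t /=.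
  have [tT|tT] := leP `|t| T; last by rewrite hK ?mulr0//= leNgt tT.
  have : - T <= t by move: tT; rewrite ler_norml => /andP[].
  by move=> Tt; rewrite ltNge (ltW (lt_le_trans xNT Tt)) mul0r.
pose s (t : R) := 2^-1 + (4 * T)^-1 * (t - x).
have T4 : 0 < 4 * T by rewrite mulr_gt0.
have hx : null_freq [set w | `|w| < d] [set t | `|t| <= T]
    (fun t => (s t < 2^-1)%R%:R * h t).
  apply: null_freq_step => //.
  - move=> f fd; have := null_freq_mulX fd.
    move/(null_freq_lin (2^-1 - (4 * T)^-1 * x) (4 * T)^-1 fd).
    by congr null_freq; apply/funext => t; rewrite /s /=; ring.
  - move=> t h0; have tT : `|t| <= T.
      by apply: contrapT => Kt; move: h0; rewrite hK ?eqxx.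
    move: tT; rewrite ler_norml /s => /andP[? ?].
    have e : (4 * T)^-1 * (t - x) * (4 * T) = t - x.
      by rewrite mulrAC mulVf ?mul1r// gt_eqF.
    apply/andP; split; nra.
rewrite -[RHS](null_freq_Rintegral0 D0 hx); apply: eq_Rintegral => t _.
congr ((nat_of_bool _)%:R * _); rewrite /s -(subr_lt0 x t).
rewrite -(pmulr_rlt0 (t - x) (_ : 0 < (4 * T)^-1)) ?invr_gt0//.
by apply/idP/idP; lra.
Qed.

End fourier_uniqueness.

(** * Complex integrals and the Fourier transform *)

Section complex_integral.
Context {R : realType}.
Local Notation mu := (@lebesgue_measure R).
Local Open Scope complex_scope.
Implicit Types (F G : R -> R[i]) (z : R[i]).

Lemma cReM z1 z2 : complex.Re (z1 * z2) =
  complex.Re z1 * complex.Re z2 - complex.Im z1 * complex.Im z2.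
Proof. by case: z1 z2 => [? ?] []. Qed.

Lemma cImM z1 z2 : complex.Im (z1 * z2) =
  complex.Re z1 * complex.Im z2 + complex.Im z1 * complex.Re z2.
Proof. by case: z1 z2 => [? ?] []. Qed.

Lemma cReB z1 z2 : complex.Re (z1 - z2) = complex.Re z1 - complex.Re z2.
Proof. by case: z1 z2 => [? ?] []. Qed.

Lemma cImB z1 z2 : complex.Im (z1 - z2) = complex.Im z1 - complex.Im z2.
Proof. by case: z1 z2 => [? ?] []. Qed.

Lemma complex_inj z1 z2 : complex.Re z1 = complex.Re z2 ->
  complex.Im z1 = complex.Im z2 -> z1 = z2.
Proof. by case: z1 z2 => [? ?] [? ?] /= -> ->. Qed.

Lemma expiD (x y : R) : expi (x + y) = expi x * expi y.
Proof.
by apply: complex_inj; rewrite ?cReM ?cImM /= ?cosD ?sinD// addrC.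
Qed.

Lemma expi0 : expi (0 : R) = 1.
Proof. by rewrite /expi cos0 sin0. Qed.

Lemma expi_neq0 (x : R) : expi x != 0.
Proof.
apply/eqP => x0; have := @oner_neq0 R[i].
by rewrite -expi0 -(subrr x) expiD x0 mul0r eqxx.
Qed.

Definition cintegrable F :=
  mu.-integrable setT (EFin \o (fun t => complex.Re (F t))) /\
  mu.-integrable setT (EFin \o (fun t => complex.Im (F t))).

Lemma eq_cintegral F G : F =1 G -> cintegral F = cintegral G.
Proof. by move=> /funext ->. Qed.

Lemma cintegrable_expi (g : R -> R) F : measurable_fun setT g ->
  cintegrable F -> cintegrable (fun t => expi (g t) * F t).
Proof.
move=> mg [ix iy].
have mcos : measurable_fun setT (fun t => cos (g t)).
  by apply: measurableT_comp => //; apply: continuous_measurable_fun;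
    exact: continuous_cos.
have msin : measurable_fun setT (fun t => sin (g t)).
  by apply: measurableT_comp => //; apply: continuous_measurable_fun;
    exact: continuous_sin.
have cos1 t : `|cos (g t)| <= 1 by exact: cos_max.
have sin1 t : `|sin (g t)| <= 1 by exact: sin_max.
have icos h := @integrable_mul_bounded1 _ _ h mcos cos1.
have isin h := @integrable_mul_bounded1 _ _ h msin sin1.
split.
- have := integrable_lin 1 (-1) (icos _ ix) (isin _ iy).
  by congr integrable; apply/funext => t /=; rewrite cReM /= mul1r mulN1r.
- have := integrable_lin 1 1 (icos _ iy) (isin _ ix).
  by congr integrable; apply/funext => t /=; rewrite cImM /= !mul1r.
Qed.

Lemma cintegrableB F G : cintegrable F -> cintegrable G ->
  cintegrable (fun t => F t - G t).
Proof.
move=> [fx fy] [gx gy]; split.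
- have := integrable_lin 1 (-1) fx gx.
  by congr integrable; apply/funext => t /=; rewrite cReB mul1r mulN1r.
- have := integrable_lin 1 (-1) fy gy.
  by congr integrable; apply/funext => t /=; rewrite cImB mul1r mulN1r.
Qed.

Lemma cintegralZl z F : cintegrable F ->
  cintegral (fun t => z * F t) = z * cintegral F.
Proof.
move=> [ix iy]; apply: complex_inj; rewrite ?cReM ?cImM /=.
- rewrite -mulNr -Rintegral_lin//; apply: eq_Rintegral => t _.
  by rewrite cReM mulNr.
- by rewrite -Rintegral_lin//; apply: eq_Rintegral => t _; rewrite cImM.
Qed.

Lemma cintegralB F G : cintegrable F -> cintegrable G ->
  cintegral (fun t => F t - G t) = cintegral F - cintegral G.
Proof.
move=> [fx fy] [gx gy]; apply: complex_inj; rewrite ?cReB ?cImB /=.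
- by rewrite -RintegralB//; apply: eq_Rintegral => t _; rewrite cReB.
- by rewrite -RintegralB//; apply: eq_Rintegral => t _; rewrite cImB.
Qed.

Lemma cintegral_ae F G : cintegrable F -> cintegrable G ->
  ae_eq mu setT F G -> cintegral F = cintegral G.
Proof.
move=> [fx fy] [gx gy] FG; apply: complex_inj; rewrite /= /Rintegral; congr fine;
  apply: ae_eq_integral => //;
  try (by apply/measurable_EFinP; exact: measurable_Rfun_integrable);
  by apply: filterS FG => t /= FGt _; rewrite FGt.
Qed.

Definition fourier F (w : R) : R[i] :=
  cintegral (fun t => expi (- (w * t)) * F t).

Lemma measurable_freq (w : R) : measurable_fun setT (fun t : R => - (w * t)).
Proof. by apply: measurableT_comp => //; exact: measurable_funM. Qed.

Lemma fourierB F G w : cintegrable F -> cintegrable G ->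
  fourier (fun t => F t - G t) w = fourier F w - fourier G w.
Proof.
move=> iF iG; rewrite /fourier -cintegralB.
- by apply: eq_cintegral => t; rewrite mulrBr.
- exact: cintegrable_expi (measurable_freq w) iF.
- exact: cintegrable_expi (measurable_freq w) iG.
Qed.

Lemma ae_eq_fourier F G w : cintegrable F -> cintegrable G ->
  ae_eq mu setT F G -> fourier F w = fourier G w.
Proof.
move=> iF iG FG; apply: cintegral_ae.
- exact: cintegrable_expi (measurable_freq w) iF.
- exact: cintegrable_expi (measurable_freq w) iG.
- by apply: filterS FG => t /= FGt _; rewrite FGt.
Qed.

Lemma Re_fourier F w : cintegrable F -> complex.Re (fourier F w) =
  \int[mu]_t (cos (w * t) * complex.Re (F t)) +
  \int[mu]_t (sin (w * t) * complex.Im (F t)).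
Proof.
move=> [ix iy]; rewrite -RintegralD//=; last 2 first.
- exact: integrable_cosM.
- exact: integrable_sinM.
by apply: eq_Rintegral => t _; rewrite cReM /= cosN sinN mulNr opprK.
Qed.

Lemma Im_fourier F w : cintegrable F -> complex.Im (fourier F w) =
  \int[mu]_t (cos (w * t) * complex.Im (F t)) -
  \int[mu]_t (sin (w * t) * complex.Re (F t)).
Proof.
move=> [ix iy]; rewrite -RintegralB//=; last 2 first.
- exact: integrable_cosM.
- exact: integrable_sinM.
by apply: eq_Rintegral => t _; rewrite cImM /= cosN sinN mulNr.
Qed.

(** The real part of [fourier F w] is the cosine integral of the real part of
    [F] plus the sine integral of its imaginary part.  Comparing [w] with [- w]
    changes the sign of the second term only and so separates the two. *)
Lemma null_freq_fourier (D K : set R) F : cintegrable F ->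
  (forall w, D w -> D (- w)) -> (forall t, ~ K t -> F t = 0) ->
  (forall w, D w -> fourier F w = 0) ->
  null_freq D K (fun t => complex.Re (F t)) /\
  null_freq D K (fun t => complex.Im (F t)).
Proof.
move=> iF DN FK F0; have [ix iy] := iF.
have cosE w f :
    \int[mu]_t (cos (- w * t) * f t) = \int[mu]_t (cos (w * t) * f t).
  by apply: eq_Rintegral => t _; rewrite mulNr cosN.
have sinE w f : mu.-integrable setT (EFin \o f) ->
    \int[mu]_t (sin (- w * t) * f t) = - \int[mu]_t (sin (w * t) * f t).
  move=> fi; rewrite -[RHS]mulN1r -RintegralZl//; last exact: integrable_sinM.
  by apply: eq_Rintegral => t _; rewrite mulNr sinN mulNr mulN1r.
have key w : D w ->
    [/\ \int[mu]_t (cos (w * t) * complex.Re (F t)) = 0,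
        \int[mu]_t (sin (w * t) * complex.Re (F t)) = 0,
        \int[mu]_t (cos (w * t) * complex.Im (F t)) = 0 &
        \int[mu]_t (sin (w * t) * complex.Im (F t)) = 0].
  move=> Dw; have := F0 _ Dw; have := F0 _ (DN _ Dw) => Fn Fp.
  have := Re_fourier w iF; have := Re_fourier (- w) iF.
  have := Im_fourier w iF; have := Im_fourier (- w) iF.
  rewrite Fn Fp !cosE !sinE//= => ? ? ? ?; split; lra.
split; split => //.
- by move=> t Kt; rewrite FK.
- by move=> w /key[].
- by move=> t Kt; rewrite FK.
- by move=> w /key[].
Qed.

Lemma complex_ae0 F : ae_eq mu setT (fun t => complex.Re (F t)) (cst 0) ->
  ae_eq mu setT (fun t => complex.Im (F t)) (cst 0) -> ae_eq mu setT F (cst 0).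
Proof.
by apply: filterS2 => t /= re0 im0 _; apply: complex_inj; rewrite ?re0 ?im0.
Qed.

Lemma fourier_eq0 F : cintegrable F -> (forall w, fourier F w = 0) ->
  ae_eq mu setT F (cst 0).
Proof.
move=> iF F0; have [//|t []//|//|rF mF] := @null_freq_fourier setT setT F iF.
exact: complex_ae0 (null_freq_setT_ae0 rF) (null_freq_setT_ae0 mF).
Qed.

Lemma fourier_expi F (v w : R) :
  fourier (fun t => expi (- (v * t)) * F t) w = fourier F (v + w).
Proof.
by apply: eq_cintegral => t; rewrite mulrA -expiD mulrDl opprD addrC.
Qed.

(** The factor [expi (- (v t))] moves the interval of frequencies to one that is
    centred at zero, which is symmetric. *)
Lemma compact_fourier_eq0 F (T d v : R) : cintegrable F -> 0 < d ->
  (forall t, T < `|t| -> F t = 0) ->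
  (forall w, `|w - v| < d -> fourier F w = 0) ->
  ae_eq mu setT F (cst 0).
Proof.
move=> iF d0 FT F0.
have iG := cintegrable_expi (measurable_freq v) iF.
have [|||rG mG] := @null_freq_fourier [set w | `|w| < d] [set t | `|t| <= T]
  (fun t => expi (- (v * t)) * F t) iG.
- by move=> w /=; rewrite normrN.
- by move=> t /negP; rewrite -ltNge => /FT ->; rewrite mulr0.
- by move=> w wd; rewrite fourier_expi F0// addrC addKr.
have := complex_ae0 (null_freq_compact_ae0 d0 rG) (null_freq_compact_ae0 d0 mG).
apply: filterS => t /(_ I)/eqP; rewrite mulf_eq0 (negbTE (expi_neq0 _))/=.
by move=> /eqP.
Qed.

Lemma fourier_neq0_near F (v : R) : cintegrable F -> fourier F v != 0 ->
  exists2 d, 0 < d & forall w, `|w - v| < d -> fourier F w != 0.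
Proof.
move=> iF; have [ix iy] := iF => Fv.
have cont (k f : R -> R) : continuous k -> (forall x, `|k x| <= 1) ->
    mu.-integrable setT (EFin \o f) ->
    {for v, continuous (fun w : R => \int[mu]_t (k (w * t) * f t) : R)}.
  move=> ck k1 fi.
  apply: (@continuity_under_integral _ _ _ mu (fun w t => k (w * t) * f t)
    setT measurableT (v - 1) (v + 1) _ _ (fun t => `|f t|)).
  - move=> w _; apply: integrable_mul_bounded1 => //.
    by apply: measurableT_comp; [exact: continuous_measurable_fun|
      exact: measurable_funM].
  - apply: aeW => t _ w _; apply: cvgM; last exact: cvg_cst.
    apply: continuous_cvg; first exact: ck.
    by apply: cvgM; [exact: cvg_id|exact: cvg_cst].
  - exact: (integrable_norm fi).
  - move=> w _; apply: aeW => t _.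
    by rewrite normrM -[leRHS]mul1r ler_wpM2r.
  - by rewrite inE /= in_itv /=; apply/andP; split; lra.
have nz (f : R -> R) : {for v, continuous f} -> f v != 0 ->
    exists2 d, 0 < d & forall w, `|w - v| < d -> f w != 0.
  move=> /cvgrPdist_lt cf fv.
  have /nbhs_ballP[d /= d0 df] : \forall w \near v, `|f v - f w| < `|f v|.
    by apply: cf; rewrite normr_gt0.
  exists d => // w wd; apply/eqP => fw0.
  have := df w; rewrite /ball /= distrC fw0 subr0 ltxx => /(_ wd).
  by [].
have [re0|re0] := eqVneq (complex.Re (fourier F v)) 0; last first.
  have [|d d0 df] := nz (fun w => complex.Re (fourier F w)) _ re0.
    under [X in {for v, continuous X}]eq_fun do rewrite (Re_fourier _ iF).
    apply: cvgD.
    - by apply: (cont cos) => // [|x]; [exact: continuous_cos|exact: cos_max].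
    - by apply: (cont sin) => // [|x]; [exact: continuous_sin|exact: sin_max].
  by exists d => // w /df; apply: contra_neq => ->.
have [||d d0 df] := nz (fun w => complex.Im (fourier F w)).
- under [X in {for v, continuous X}]eq_fun do rewrite (Im_fourier _ iF).
  apply: cvgB.
  - by apply: (cont cos) => // [|x]; [exact: continuous_cos|exact: cos_max].
  - by apply: (cont sin) => // [|x]; [exact: continuous_sin|exact: sin_max].
- by apply: contra_neq Fv => im0; apply: complex_inj; rewrite ?re0 ?im0.
by exists d => // w /df; apply: contra_neq => ->.
Qed.

End complex_integral.

(** * The convolution theorem *)

Section convolution_theory.
Context {R : realType}.
Local Notation mu := (@lebesgue_measure R).
Local Open Scope complex_scope.
Implicit Types (f g : R -> R) (F G : R -> R[i]).

(** Translation invariance, from the fact that a measure that agrees with the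
    Lebesgue measure on half-open intervals is the Lebesgue measure. *)
Lemma pushforward_shift (a : R) (A : set (measurableTypeR R)) : measurable A ->
  pushforward mu (fun t : R => t - a : measurableTypeR R) A = mu A.
Proof.
have msub : measurable_fun setT (fun t : R => t - a : measurableTypeR R).
  exact: measurable_funB.
move=> mA; apply/esym.
apply: (@lebesgue_measure_unique R
  (@pushforward _ _ _ _ _ mu (fun t : R => t - a : measurableTypeR R))) => //=.
move=> _ [[x y]] _ <-.
rewrite /pushforward (_ : _ @^-1` _ = `]x + a, y + a]%classic); last first.
  by apply/seteqP; split => t /=; rewrite !in_itv/= ltrBrDr lerBlDr.
rewrite !lebesgue_measure_itv/= !lte_fin ltrD2r -!EFinB.
by rewrite opprD addrACA subrr addr0.
Qed.

Lemma measurable_subr (a : R) :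
  measurable_fun setT (fun t : R => t - a : measurableTypeR R).
Proof. exact: measurable_funB. Qed.

Lemma ge0_integral_shift (f : R -> \bar R) (a : R) : measurable_fun setT f ->
  (forall t, 0 <= f t)%E -> (\int[mu]_t f (t - a)%R = \int[mu]_t f t)%E.
Proof.
move=> mf f0.
have := @ge0_integral_pushforward _ _ (measurableTypeR R) (measurableTypeR R) R _
  (measurable_subr a) mu setT f measurableT mf (fun t _ => f0 t).
rewrite preimage_setT => <-.
apply: eq_measure_integral => [|? A mA _]; first exact: measurable_subr.
exact: pushforward_shift.
Qed.

Lemma integrable_shift f (a : R) : mu.-integrable setT (EFin \o f) ->
  mu.-integrable setT (EFin \o (fun t => f (t - a))).
Proof.
move=> /integrableP[mf foo]; apply/integrableP; split.
  exact: (measurableT_comp mf (measurable_subr a)).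
rewrite (ge0_integral_shift (f := fun t => `|(f t)%:E|)%E)//.
exact: measurableT_comp.
Qed.

Lemma Rintegral_shift f (a : R) : mu.-integrable setT (EFin \o f) ->
  \int[mu]_t f (t - a) = \int[mu]_t f t.
Proof.
move=> fi; congr fine.
have := @integral_pushforward _ _ (measurableTypeR R) (measurableTypeR R) R _
  (measurable_subr a) mu setT (EFin \o f) (measurable_int _ fi) _ measurableT.
rewrite preimage_setT => <-; last exact: integrable_shift.
apply: eq_measure_integral => [|? A mA _]; first exact: measurable_subr.
exact: pushforward_shift.
Qed.

Lemma integrable_convolution_kernel f g : mu.-integrable setT (EFin \o f) ->
  mu.-integrable setT (EFin \o g) ->
  (mu \x mu)%E.-integrable setT
    (EFin \o (fun p : R * R => f p.2 * g (p.1 - p.2))).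
Proof.
move=> fi gi.
have mf := measurable_Rfun_integrable fi.
have mg := measurable_Rfun_integrable gi.
apply/integrable21ltyP.
  apply/measurable_EFinP; apply: measurable_funM.
    exact: measurableT_comp.
  by apply: (measurableT_comp mg); exact: measurable_funB.
have inner s : (\int[mu]_t `|(f s * g (t - s)%R)%:E| =
    `|(f s)%:E| * \int[mu]_t `|(g t)%:E|)%E.
  under eq_integral do rewrite EFinM abseM.
  rewrite ge0_integralZl//; last first.
    apply: measurableT_comp => //; apply/measurable_EFinP.
    exact: (measurableT_comp mg (measurable_subr s)).
  rewrite (ge0_integral_shift (f := fun t => `|(g t)%:E|)%E)//.
  by apply: measurableT_comp => //; exact/measurable_EFinP.
rewrite [ltLHS](_ : _ =
    \int[mu]_s (`|(f s)%:E| * \int[mu]_t `|(g t)%:E|))%E; last first.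
  by apply: eq_integral => s _; exact: inner.
rewrite ge0_integralZr// ?integral_ge0//; last first.
  by apply: measurableT_comp => //; exact/measurable_EFinP.
apply: lte_mul_pinfty; [exact: integral_ge0| |by case/integrableP: gi].
by rewrite ge0_fin_numE ?integral_ge0//; case/integrableP: fi.
Qed.

Lemma integrable_fine (f : R -> \bar R) : mu.-integrable setT f ->
  mu.-integrable setT (EFin \o (fine \o f)).
Proof.
move=> fi; have mf := measurable_int _ fi.
apply: (le_integrable measurableT _ _ fi).
  by apply/measurable_EFinP; exact: measurableT_comp.
by move=> t _ /=; case: (f t) => [r| |] /=; rewrite ?lexx// normr0 leey.
Qed.

(** For real-valued integrals the partial integrals take a default value where
    the section is not integrable; this concerns a null set only. *)
Lemma Rfubini (q : R * R -> R) : (mu \x mu)%E.-integrable setT (EFin \o q) ->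
  [/\ mu.-integrable setT (EFin \o (fun t => \int[mu]_s q (t, s))),
      {ae mu, forall t, mu.-integrable setT (EFin \o (fun s => q (t, s)))} &
      \int[mu]_t (\int[mu]_s q (t, s)) = \int[mu]_s (\int[mu]_t q (t, s))].
Proof.
move=> qi; have iF := integrable_fubini_F qi.
split.
- exact: (integrable_fine iF).
- exact: (ae_integrable1 qi).
- rewrite /Rintegral; congr fine.
  transitivity (\int[mu]_t fubini_F mu (EFin \o q) t)%E.
    apply: ae_eq_integral => //.
    + by have /measurable_int := integrable_fine iF.
    + exact: measurable_int iF.
    + have /= := integrable_ae measurableT iF.
      by apply: filterS => t /(_ I) ft _; rewrite fineK.
  rewrite (integral12_prod_meas1 qi) -(integral21_prod_meas1 qi).
  apply: ae_eq_integral => //.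
  + exact: (measurable_fubini_G qi).
  + apply/measurable_EFinP; apply: measurableT_comp => //.
    exact: (measurable_fubini_G qi).
  + have := ae_integrable2 qi.
    apply: filterS => t it _; rewrite /= fineK//.
    exact: (integrable_fin_num measurableT it).
Qed.

Definition convolution F G (t : R) : R[i] :=
  cintegral (fun s => F s * G (t - s)).

Section convolution_lemmas.
Variables (F G : R -> R[i]).
Hypotheses (iF : cintegrable F) (iG : cintegrable G).

Let kernel_Re : (mu \x mu)%E.-integrable setT
  (EFin \o (fun p : R * R => complex.Re (F p.2 * G (p.1 - p.2)))).
Proof.
have [Fx Fy] := iF; have [Gx Gy] := iG.
have := integrableB measurableT (integrable_convolution_kernel Fx Gx)
  (integrable_convolution_kernel Fy Gy).
by congr integrable; apply/funext => p; rewrite /comp cReM EFinB.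
Qed.

Let kernel_Im : (mu \x mu)%E.-integrable setT
  (EFin \o (fun p : R * R => complex.Im (F p.2 * G (p.1 - p.2)))).
Proof.
have [Fx Fy] := iF; have [Gx Gy] := iG.
have := integrableD measurableT (integrable_convolution_kernel Fx Gy)
  (integrable_convolution_kernel Fy Gx).
by congr integrable; apply/funext => p; rewrite /comp cImM EFinD.
Qed.

Lemma cintegrable_convolution : cintegrable (convolution F G).
Proof.
by have [? _ _] := Rfubini kernel_Re; have [? _ _] := Rfubini kernel_Im.
Qed.

Lemma cintegrable_shift a : cintegrable (fun t => G (t - a)).
Proof.
have [x y] := iG.
by split; [exact: (integrable_shift a x)|exact: (integrable_shift a y)].
Qed.

Lemma cintegral_shift a : cintegral (fun t => G (t - a)) = cintegral G.
Proof.
have [x y] := iG; rewrite /cintegral.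
by rewrite (Rintegral_shift a x) (Rintegral_shift a y).
Qed.

(** The value of the Fourier transform at frequency zero: Fubini and translation
    invariance. *)
Lemma cintegral_convolution :
  cintegral (convolution F G) = cintegral F * cintegral G.
Proof.
transitivity (cintegral (fun s => cintegral (fun t => F s * G (t - s)))).
  have [_ _ reE] := Rfubini kernel_Re; have [_ _ imE] := Rfubini kernel_Im.
  by rewrite /convolution /cintegral /= reE imE.
transitivity (cintegral (fun s => cintegral G * F s)).
  apply: eq_cintegral => s.
  by rewrite cintegralZl ?cintegral_shift 1?mulrC//; exact: cintegrable_shift.
by rewrite cintegralZl// mulrC.
Qed.

(** A complex factor mixes real and imaginary parts, so that it can be pulled out
    of the integral only at the points [t] where the kernel is integrable. *)
Lemma ae_convolutionZl : {ae mu, forall t, forall z,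
  cintegral (fun s => z * (F s * G (t - s))) = z * convolution F G t}.
Proof.
have [_ + _] := Rfubini kernel_Re; have [_ + _] := Rfubini kernel_Im.
apply: filterS2; first exact: (ae_filter_ringOfSetsType mu).
by move=> t im re z; rewrite cintegralZl.
Qed.

End convolution_lemmas.

(** Since [expi (- (w t)) = expi (- (w s)) * expi (- (w (t - s)))], modulating a
    convolution amounts to modulating both functions, and only frequency zero
    remains. *)
Lemma fourier_convolution F G (w : R) : cintegrable F -> cintegrable G ->
  fourier (convolution F G) w = fourier F w * fourier G w.
Proof.
move=> iF iG; have mw := measurable_freq w.
have iF' := cintegrable_expi mw iF; have iG' := cintegrable_expi mw iG.
rewrite /fourier -(cintegral_convolution iF' iG'); apply: cintegral_ae.
- exact: cintegrable_expi mw (cintegrable_convolution iF iG).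
- exact: cintegrable_convolution iF' iG'.
have := ae_convolutionZl iF iG.
apply: filterS; first exact: (ae_filter_ringOfSetsType mu).
move=> t cZ _; rewrite -cZ /convolution; apply: eq_cintegral => s.
rewrite (_ : - (w * t) = - (w * s) + - (w * (t - s))); last by ring.
by rewrite expiD; ring.
Qed.

End convolution_theory.

(** * Classes of equivalence relations *)

Section eclass_bijection.
Variables (T U : Type) (eT : T -> T -> Prop) (eU : U -> U -> Prop).
Variable phi : T -> U.
Hypothesis eU_refl : forall u, eU u u.
Hypothesis eU_sym : forall u v, eU u v -> eU v u.
Hypothesis eU_trans : forall u v w, eU u v -> eU v w -> eU u w.
Hypothesis phiP : forall x y, eT x y <-> eU (phi x) (phi y).
Hypothesis phi_onto : forall u, exists x, eU (phi x) u.

Lemma to_eclassP V (e : V -> V -> Prop) : (forall u, e u u) ->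
  (forall u v, e u v -> e v u) -> (forall u v w, e u v -> e v w -> e u w) ->
  forall u v, to_eclass e u = to_eclass e v <-> e u v.
Proof.
move=> er es et u v; split=> [/(congr1 val)/= uv|uv].
  have : eclass e v v by exact: er.
  by rewrite -uv.
apply: val_inj => /=; apply/seteqP; split => w /=.
  exact/et/es.
exact: et.
Qed.

Lemma to_eclass_onto V (e : V -> V -> Prop) (X : eclasses e) :
  exists x, to_eclass e x = X.
Proof.
have /set_mem[x _ xX] := valP X.
by exists x; exact: val_inj.
Qed.

(** [phi] preserves and reflects the relations and reaches every class, hence it
    descends to a bijection.  The relation [eT] inherits the properties of an
    equivalence relation from [eU]. *)
Lemma eclasses_bijection :
  exists L : eclasses eT -> eclasses eU,
    (forall x, L (to_eclass eT x) = to_eclass eU (phi x)) /\ bijective L.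
Proof.
have eTP := @to_eclassP _ eT (fun x => (phiP x x).2 (eU_refl _))
  (fun x y xy => (phiP y x).2 (eU_sym ((phiP x y).1 xy)))
  (fun x y z xy yz =>
    (phiP x z).2 (eU_trans ((phiP x y).1 xy) ((phiP y z).1 yz))).
have eUP := to_eclassP eU_refl eU_sym eU_trans.
pose rep X := projT1 (cid (@to_eclass_onto _ eT X)).
have repK X : to_eclass eT (rep X) = X by rewrite /rep; case: cid.
pose L X := to_eclass eU (phi (rep X)).
have LE x : L (to_eclass eT x) = to_eclass eU (phi x).
  by apply/eUP/phiP/eTP; rewrite repK.
exists L; split => //.
have onto Y : exists X, L X = Y.
  have [u <-] := to_eclass_onto Y; have [x xu] := phi_onto u.
  by exists (to_eclass eT x); rewrite LE; exact/eUP.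
have [g gK] := choice onto.
exists g => // X.
rewrite -(repK (g (L X))) -[RHS]repK; apply/eTP/phiP/eUP.
by rewrite -/(L _) gK.
Qed.

End eclass_bijection.

(** * The linear canonical transform as a Fourier transform *)

Section lct_theory.
Context {R : realType} (A : lct_param R).
Local Notation mu := (@lebesgue_measure R).
Local Notation a := (lct_a A).
Local Notation b := (lct_b A).
Local Notation d := (lct_d A).
Hypothesis b0 : b != 0.
Local Open Scope complex_scope.
Implicit Types f g : R -> R[i].

Lemma isL12_cintegrable f : isL12 f -> cintegrable f.
Proof.
move=> [mx my + _]; rewrite /finite_norm Lnorm1 => foo.
have le_normc (z : R[i]) :
    `|complex.Re z| <= Normc.normc z /\ `|complex.Im z| <= Normc.normc z.
  case: z => x y /=; rewrite -!sqrtr_sqr !ler_wsqrtr//.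
    by rewrite lerDr sqr_ge0.
  by rewrite lerDl sqr_ge0.
have normE t : Normc.normc (f t) =
    Num.sqrt (complex.Re (f t) ^+ 2 + complex.Im (f t) ^+ 2) by case: (f t).
have mnorm : measurable_fun setT (fun t => Normc.normc (f t)).
  have msqrt : measurable_fun setT (@Num.sqrt R).
    by apply: continuous_measurable_fun; exact: sqrt_continuous.
  rewrite (funext normE); apply: (measurableT_comp msqrt).
  by apply: measurable_funD; exact: measurable_funX.
have inorm : mu.-integrable setT (EFin \o (fun t => Normc.normc (f t))).
  by apply/integrableP; split => //; exact/measurable_EFinP.
split; apply: (le_integrable measurableT _ _ inorm); try exact/measurable_EFinP.
- move=> t _; rewrite /= lee_fin (le_trans (le_normc _).1)//; exact: ler_norm.
- move=> t _; rewrite /= lee_fin (le_trans (le_normc _).2)//; exact: ler_norm.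
Qed.

Definition chirp f (t : R) : R[i] := expi (a * t ^+ 2 / (2 * b)) * f t.

Lemma cintegrable_chirp f : cintegrable f -> cintegrable (chirp f).
Proof.
apply: cintegrable_expi; apply: measurable_funM => //.
by apply: measurable_funM => //; exact: measurable_funX.
Qed.

Definition lct_factor (u : R) : R[i] :=
  sqrtc (1 / (2%:R * (pi * b)%:C * 'i)) * expi (d * u ^+ 2 / (2 * b)).

Lemma lct_factor_neq0 u : lct_factor u != 0.
Proof.
rewrite mulf_neq0 ?expi_neq0// sqrtc_eq0 mul1r invr_eq0 !mulf_neq0//.
- by rewrite eq_complex /= eqxx andbT mulf_neq0// gt_eqF// pi_gt0.
- by rewrite eq_complex /= oner_eq0 andbF.
Qed.

Lemma lctE f u : cintegrable f ->
  lct A f u = lct_factor u * fourier (chirp f) (u / b).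
Proof.
move=> fi; rewrite /lct /lct_factor /fourier -[RHS]mulrA.
rewrite -[in RHS]cintegralZl; last first.
  exact: cintegrable_expi (measurable_freq _) (cintegrable_chirp fi).
congr (_ * _); apply: eq_cintegral => t.
rewrite /chirp !mulrA -!expiD; congr (expi _ * _); field.
by rewrite b0.
Qed.

(** The identity behind this is
    [s (s - t) a/b = - a t^2 / 2b + (a s^2 / 2b + a (t - s)^2 / 2b)]. *)
Lemma ae_lct_conv f g : cintegrable f -> cintegrable g ->
  ae_eq mu setT (lct_conv A f g)
    (fun t =>
      expi (- (a * t ^+ 2 / (2 * b))) * convolution (chirp f) (chirp g) t).
Proof.
move=> fi gi.
have := ae_convolutionZl (cintegrable_chirp fi) (cintegrable_chirp gi).
apply: filterS; first exact: (ae_filter_ringOfSetsType mu).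
move=> t cZ _; rewrite -cZ; apply: eq_cintegral => s.
rewrite /chirp (_ : s * (s - t) * (a / b) = - (a * t ^+ 2 / (2 * b)) +
  (a * s ^+ 2 / (2 * b) + a * (t - s) ^+ 2 / (2 * b))); last by field; rewrite b0.
by rewrite !expiD; ring.
Qed.

Lemma ae_eq_lct_conv f1 g1 f2 g2 : cintegrable f1 -> cintegrable g1 ->
  cintegrable f2 -> cintegrable g2 ->
  ae_eq mu setT (lct_conv A f1 g1) (lct_conv A f2 g2) <->
  (forall w, fourier (chirp f1) w * fourier (chirp g1) w =
             fourier (chirp f2) w * fourier (chirp g2) w).
Proof.
move=> if1 ig1 if2 ig2.
have [iF1 iG1] := (cintegrable_chirp if1, cintegrable_chirp ig1).
have [iF2 iG2] := (cintegrable_chirp if2, cintegrable_chirp ig2).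
have [c1 c2] := (ae_lct_conv if1 ig1, ae_lct_conv if2 ig2).
have ic1 := cintegrable_convolution iF1 iG1.
have ic2 := cintegrable_convolution iF2 iG2.
split=> [c12 w|F12].
- rewrite -(fourier_convolution w iF1 iG1) -(fourier_convolution w iF2 iG2).
  apply: (ae_eq_fourier w ic1 ic2).
  have := ae_eq_trans (ae_eq_sym c1) (ae_eq_trans c12 c2).
  by apply: filterS => t /(_ I)/(mulfI (expi_neq0 _)).
- apply: (ae_eq_trans c1); apply: ae_eq_sym; apply: (ae_eq_trans c2).
  have B0 : ae_eq mu setT
      (convolution (chirp f1) (chirp g1) \- convolution (chirp f2) (chirp g2))
      (cst 0).
    apply: fourier_eq0 (cintegrableB ic1 ic2) _ => w.
    by rewrite fourierB// !fourier_convolution// F12 subrr.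
  by apply: filterS B0 => t /(_ I)/subr0_eq /= -> _.
Qed.

(** The evaluation point [w * b] is the one at which [lct] sees frequency [w]. *)
Lemma lct_mul_eq f1 g1 f2 g2 : cintegrable f1 -> cintegrable g1 ->
  cintegrable f2 -> cintegrable g2 ->
  lct A f1 \* lct A g1 = lct A f2 \* lct A g2 <->
  (forall w, fourier (chirp f1) w * fourier (chirp g1) w =
             fourier (chirp f2) w * fourier (chirp g2) w).
Proof.
move=> if1 ig1 if2 ig2; split=> [e w|e].
  have := congr1 (@^~ (w * b)) e; rewrite /= !lctE// mulfK//.
  rewrite mulrACA [RHS]mulrACA => /mulfI; apply.
  by rewrite mulf_neq0// lct_factor_neq0.
apply/funext => u; rewrite /= !lctE// mulrACA [RHS]mulrACA.
by rewrite e.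
Qed.

(** If the transform of [H] is nonzero at some point, then by continuity it is
    nonzero on an interval.  There the transform of [D] vanishes, so [D] is null,
    which contradicts its nonzero integral. *)
Lemma fourier_cancel D (T : R) H : cintegrable D -> cintegrable H ->
  (forall t, T < `|t| -> D t = 0) -> cintegral D != 0 ->
  (forall w, fourier D w * fourier H w = 0) -> forall w, fourier H w = 0.
Proof.
move=> iD iH DT D0 DH w; apply: contrapT => /eqP Hw.
have [e e0 He] := fourier_neq0_near iH Hw.
have De : forall v, `|v - w| < e -> fourier D v = 0.
  move=> v /He Hv; have := DH v => /eqP; rewrite mulf_eq0 (negbTE Hv) orbF.
  by move=> /eqP.
have D_ae0 := compact_fourier_eq0 iD e0 DT De.
have i0 : cintegrable (cst 0 : R -> R[i]) by split; exact: integrable0.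
move: D0; rewrite (cintegral_ae iD i0 D_ae0) /cintegral /=.
by rewrite !Rintegral_cst// mul0r eqxx.
Qed.

End lct_theory.

(** * Quotients of sequences and Boehmians *)

Section boehmians.
Context {R : realType} (A : lct_param R).
Local Notation mu := (@lebesgue_measure R).
Hypothesis b0 : lct_b A != 0.

Lemma L12_cintegrable (f : L12 R) : cintegrable f.
Proof. exact/isL12_cintegrable/L12funP. Qed.

Lemma delta_cintegrable delta n : delta_seq A delta -> cintegrable (delta n).
Proof. by move=> [_ _ dL _ _]; exact: isL12_cintegrable. Qed.

Lemma compact_support_bounded (f : R -> R[i]) :
  compact (closure [set t | f t != 0]) ->
  exists T, forall t, T < `|t| -> f t = 0.
Proof.
move=> /compact_bounded[M [_ Mf]].
exists (M + 1) => t Mt; apply: contrapT => /eqP ft.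
have tM : `|t| <= M + 1.
  by apply: (Mf (M + 1)); [rewrite ltrDl|exact: subset_closure].
by rewrite leNgt Mt in tM.
Qed.

(** The normalization of a delta sequence says that the Fourier transform of the
    chirped function equals one at frequency zero. *)
Lemma delta_cancel delta n (H : R -> R[i]) : delta_seq A delta ->
  cintegrable H ->
  (forall w, fourier (chirp A (delta n)) w * fourier H w = 0) ->
  forall w, fourier H w = 0.
Proof.
move=> dP iH; have [_ dK _ d1 _] := dP.
have [T dT] := compact_support_bounded (dK n).
have iD := cintegrable_chirp A (delta_cintegrable n dP).
apply: (fourier_cancel (T := T) iD iH); last by rewrite d1 oner_neq0.
by move=> t /dT; rewrite /chirp => ->; rewrite mulr0.
Qed.

Lemma lct_quotient_equiv_refl (p : lct_quotient A) : lct_quotient_equiv p p.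
Proof. by []. Qed.

Lemma lct_quotient_equiv_sym (p q : lct_quotient A) :
  lct_quotient_equiv p q -> lct_quotient_equiv q p.
Proof. by move=> pq n. Qed.

(** If [q] has denominator [y] and is equivalent to both [p] and [r], then the
    transform of [y n] times the difference of the two sides to be compared
    vanishes.  This difference is, up to a nonvanishing factor, the Fourier
    transform of an integrable function, so [delta_cancel] applies. *)
Lemma lct_quotient_equiv_trans (p q r : lct_quotient A) :
  lct_quotient_equiv p q -> lct_quotient_equiv q r -> lct_quotient_equiv p r.
Proof.
move=> pq qr n; move: (pq n) (qr n).
have [f fE] := lct_qnumP p; have [x xP xE] := lct_qdenP p.
have [g gE] := lct_qnumP q; have [y yP yE] := lct_qdenP q.
have [h hE] := lct_qnumP r; have [z zP zE] := lct_qdenP r.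
rewrite !fE !gE !hE !xE !yE !zE.
have iF := L12_cintegrable (f n).
have iG := L12_cintegrable (g n).
have iH := L12_cintegrable (h n).
have ix := delta_cintegrable n xP.
have iy := delta_cintegrable n yP.
have iz := delta_cintegrable n zP.
move=> /(lct_mul_eq b0 iF iy iG ix) fg /(lct_mul_eq b0 iG iz iH iy) gh.
apply: (lct_mul_eq b0 iF iz iH ix).2 => w.
have ifz :=
  cintegrable_convolution (cintegrable_chirp A iF) (cintegrable_chirp A iz).
have ihx :=
  cintegrable_convolution (cintegrable_chirp A iH) (cintegrable_chirp A ix).
have E v : fourier (fun t => convolution (chirp A (f n)) (chirp A (z n)) t -
      convolution (chirp A (h n)) (chirp A (x n)) t) v =
    fourier (chirp A (f n)) v * fourier (chirp A (z n)) v -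
    fourier (chirp A (h n)) v * fourier (chirp A (x n)) v.
  by rewrite fourierB// !fourier_convolution//; exact: cintegrable_chirp.
apply/eqP; rewrite -subr_eq0 -E; apply/eqP.
apply: (delta_cancel (n := n) yP (cintegrableB ifz ihx)) => v.
rewrite E mulrBr; apply/eqP; rewrite subr_eq0; apply/eqP.
have alg (F G H X Y Z : R[i]) : F * Y = G * X -> G * Z = H * Y ->
    Y * (F * Z) = Y * (H * X).
  move=> FY GZ; transitivity (F * Y * Z); first by ring.
  by rewrite FY mulrAC GZ; ring.
exact: alg (fg v) (gh v).
Qed.

(** Equality almost everywhere of convolutions is the same as equality at every
    point of products of transforms: the bridge between the two spaces of
    Boehmians. *)
Lemma ae_eq_lct_convP (f1 g1 : R -> R[i]) (f2 g2 : R -> R[i]) :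
  cintegrable f1 -> cintegrable g1 -> cintegrable f2 -> cintegrable g2 ->
  ae_eq mu setT (lct_conv A f1 g1) (lct_conv A f2 g2) <->
  lct A f1 \* lct A g1 = lct A f2 \* lct A g2.
Proof.
move=> if1 ig1 if2 ig2.
by rewrite (lct_mul_eq b0 if1 ig1 if2 ig2) (ae_eq_lct_conv b0 if1 ig1 if2 ig2).
Qed.

Lemma lct_of_qnum_qden (q : conv_quotient A) m n :
  lct A (qnum q n) \* lct A (qden q m) = lct A (qnum q m) \* lct A (qden q n).
Proof.
apply/ae_eq_lct_convP; try exact: L12_cintegrable;
  try exact: delta_cintegrable (qdenP q).
exact: qnum_qden.
Qed.

Definition lct_of_quotient (q : conv_quotient A) : lct_quotient A :=
  @LctQuotient R A (fun n => lct A (qnum q n)) (fun n => lct A (qden q n))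
    (ex_intro (fun f : nat -> L12 R => forall n, lct A (qnum q n) = lct A (f n))
      (qnum q) (fun n => erefl))
    (ex_intro2 (delta_seq A) (fun x => forall n, lct A (qden q n) = lct A (x n))
      (qden q) (qdenP q) (fun n => erefl))
    (lct_of_qnum_qden q).

Lemma lct_of_quotient_equiv (p q : conv_quotient A) :
  conv_quotient_equiv p q <->
  lct_quotient_equiv (lct_of_quotient p) (lct_of_quotient q).
Proof.
have key n := ae_eq_lct_convP (L12_cintegrable (qnum p n))
  (delta_cintegrable n (qdenP q)) (L12_cintegrable (qnum q n))
  (delta_cintegrable n (qdenP p)).
by split=> pq n; [exact/key/pq|exact/key/(pq n)].
Qed.

Lemma lct_of_quotient_onto (p : lct_quotient A) :
  exists q, lct_quotient_equiv (lct_of_quotient q) p.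
Proof.
have [f fE] := lct_qnumP p; have [x xP xE] := lct_qdenP p.
have fx m n : ae_eq mu setT (lct_conv A (f m) (x n)) (lct_conv A (f n) (x m)).
  apply/ae_eq_lct_convP; try exact: L12_cintegrable;
    try exact: delta_cintegrable xP.
  by rewrite -!fE -!xE; exact: lct_qnum_qden.
exists (ConvQuotient xP fx) => n.
by rewrite /= fE xE.
Qed.

End boehmians.

Theorem theorem3p2 (R : realType) (a b c d : R) :
  a * d - b * c = 1 -> b != 0 ->
  let A := LctParam a b c d in
  exists LA : boehmian A -> lct_boehmian A,
    (forall q : conv_quotient A, exists p : lct_quotient A,
       [/\ forall n, lct_qnum p n = lct A (qnum q n),
           forall n, lct_qden p n = lct A (qden q n) &
           LA (to_boehmian q) = to_lct_boehmian p]) /\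
    bijective LA.
Proof.
move=> _ b0 A; have bA : lct_b A != 0 by [].
have [LA [LAE LAbij]] := eclasses_bijection
  (@lct_quotient_equiv_refl R A) (@lct_quotient_equiv_sym R A)
  (lct_quotient_equiv_trans bA) (lct_of_quotient_equiv bA)
  (lct_of_quotient_onto bA).
exists LA; split=> // q; exists (lct_of_quotient bA q); split => //.
exact: LAE.
Qed.
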